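(* There exist universal numerical constants $c_0,c_1,n_0>0$ such that the following holds. Let $n\ge n_0$ be an integer, $0<u\le c_0$, and $\theta=u\times(1,1,0,\dots,0)\in\mathbb R^n$. For an $n\times n$ permutation matrix $\Pi$, let $\mathbb E_\Pi$ be the expectation when one observes $Y=X+E$ with $X=\Pi^\top\cdot T(\theta)$ and $E$ an $n\times n$ matrix with independent $\mathcal N(0,1)$ entries. Then for any estimator $\hat\Pi$ (a measurable function of $Y$ with values in the set $\mathcal S_n$ of permutation matrices), $$\max_{\Pi\in\mathcal S_n}\mathbb E_\Pi\big[\ell_2(\hat\Pi)\big]\ge c_1u\sqrt n .$$
   Context: $\theta$ is indexed as $(\theta_0,\dots,\theta_{n-1})$ and $T(\theta)$ is the $n\times n$ Toeplitz matrix with $T(\theta)_{i,j}=\theta_{|i-j|}$. For a permutation matrix $\Pi$, $\Pi\cdot M:=\Pi M\Pi^\top$. A symmetric matrix $R\in\mathbb R^{n\times n}$ is Robinson if $R_{i,1}\le\dots\le R_{i,i}\ge\dots\ge R_{i,n}$ for each $i$; $\mathcal R_n$ is the set of such matrices, and $\ell_2(\hat\Pi)=\inf_{R\in\mathcal R_n}\|\hat\Pi\cdot X-R\|_F$, where $X$ is the true signal matrix (here $X=\Pi^\top\cdot T(\theta)$ under $\mathbb E_\Pi$) and $\|\cdot\|_F$ is the Frobenius norm. *)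

(* Defs.v *)
From mathcomp Require Export all_boot all_order all_algebra all_fingroup.
From mathcomp Require Export all_classical all_reals all_analysis.

Set Implicit Arguments.
Unset Strict Implicit.
Unset Printing Implicit Defensive.

Import Order.TTheory GRing.Theory Num.Theory.

Local Open Scope classical_set_scope.
Local Open Scope ring_scope.

Lemma ltn_dist_ord (n : nat) (i j : 'I_n) : (`|i - j| < n)%N.
Proof.
by case: (leqP i j) => [le_ij | /ltnW le_ji];
   [rewrite distnEr | rewrite distnEl]; rewrite ?(leq_ltn_trans (leq_subr _ _)).
Qed.

Definition dist_ord (n : nat) (i j : 'I_n) : 'I_n := Ordinal (ltn_dist_ord i j).

Definition toeplitz (R : realType) (n : nat) (theta : 'rV[R]_n) : 'M[R]_n :=
  \matrix_(i, j) theta 0 (dist_ord i j).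

Definition two_ones (R : realType) (n : nat) : 'rV[R]_n :=
  \row_(k < n) (if (k < 2)%N then 1 else 0).

Definition conj_mx (R : realType) (n : nat) (Pi M : 'M[R]_n) : 'M[R]_n :=
  Pi *m M *m Pi^T.

Definition signal (R : realType) (n : nat) (theta : 'rV[R]_n) (s : 'S_n) :
    'M[R]_n :=
  conj_mx (perm_mx s)^T (toeplitz theta).

Definition frobenius (R : realType) (n : nat) (M : 'M[R]_n) : R :=
  Num.sqrt (\sum_i \sum_j M i j ^+ 2).

Definition robinson (R : realType) (n : nat) : set 'M[R]_n :=
  [set M | [/\ M^T = M,
     forall i j k : 'I_n, (j <= k)%N -> (k <= i)%N -> M i j <= M i k &
     forall i j k : 'I_n, (i <= j)%N -> (j <= k)%N -> M i k <= M i j]].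

Definition ell2 (R : realType) (n : nat) (X : 'M[R]_n) (s : 'S_n) : R :=
  inf [set frobenius (conj_mx (perm_mx s) X - M) | M in @robinson R n].

(* The product (Borel) sigma-algebra on matrices. *)
Definition measurable_mx (R : realType) (n : nat) : set (set 'M[R]_n) :=
  <<s \bigcup_(ij in [set: 'I_n * 'I_n])
        preimage_set_system setT (fun M : 'M[R]_n => M ij.1 ij.2) measurable >>.

(* The finite set 'S_n carries its discrete sigma-algebra. *)
Definition measurable_estimator (R : realType) (n : nat) (f : 'M[R]_n -> 'S_n) : Prop :=
  forall S : set 'S_n, @measurable_mx R n (f @^-1` S).

Definition mutually_independent (d : measure_display) (T : measurableType d)
    (R : realType) (P : probability T R) (I : finType)
    (X : I -> {RV P >-> R}) : Prop :=
  forall (J : {set I}) (B : I -> set R),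
    (forall i, i \in J -> measurable (B i)) ->
    P (\bigcap_(i in [set` J]) (X i @^-1` B i)) =
      (\prod_(i in J) P (X i @^-1` B i))%E.

(* The laws are compared on measurable sets only: as set functions they may
   differ on non-measurable sets. *)
Definition gaussian_noise (d : measure_display) (T : measurableType d)
    (R : realType) (P : probability T R) (n : nat)
    (E : 'I_n * 'I_n -> {RV P >-> R}) : Prop :=
  mutually_independent E /\
  forall ij (B : set R), measurable B ->
    distribution P (E ij) B = normal_prob 0 1 B.

Definition noise_mx (d : measure_display) (T : measurableType d)
    (R : realType) (P : probability T R) (n : nat)
    (E : 'I_n * 'I_n -> {RV P >-> R}) (w : T) : 'M[R]_n :=
  \matrix_(i, j) E (i, j) w.

(* Main.v *)
(** Conjugated by the estimate, the signal is [u] times the adjacency matrix (with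
    loops) of a path whose vertices have been placed on the line. A path edge
    joining two vertices placed at distance at least 3 forces a zero between two
    positions of its row that a Robinson matrix must order the other way, at a
    cost [u^2 / 2]; hence the loss is at least [u N / sqrt (2 n)] when [N] vertices
    have such a long edge.

    Exchange the vertices [p] and [p + 2] in the true permutation. If no edge at
    [p] or [p + 2] were long before or after the exchange, both vertices would be
    placed within distance 2 of each of the three vertices [p - 1], [p + 1],
    [p + 3], which is impossible. But the exchange changes at most 25 entries of
    the signal by at most [u], and shifting the mean of one Gaussian entry by [t]
    moves probabilities by at most [|t|], so for [u <= 1/50] the two signals are at
    total variation distance at most [1/2]. Averaging over all permutations and
    all [p] shows that on average a constant fraction of the vertices have a long
    edge. *)
Require Import Defs.
From HB Require Import structures.
From mathcomp Require Import measurable_realfun.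
From mathcomp Require Import ring lra zify.

Set Implicit Arguments.
Unset Strict Implicit.
Unset Printing Implicit Defensive.

Import Order.TTheory GRing.Theory Num.Theory.
Import numFieldTopology.Exports.

Local Open Scope classical_set_scope.
Local Open Scope ring_scope.

(** * Translated Gaussian laws *)

Lemma measurable_shift (R : realType) (t : R) :
  measurable_fun setT (fun x : R => x + t).
Proof. by apply: measurable_funD. Qed.

(** Lebesgue measure is determined by its values on half-open intervals, and its push-forward by the
    translation has the same values there. *)
Lemma lebesgue_measure_shift (R : realType) (t : R) (B : set R) :
  measurable B ->
  @lebesgue_measure R [set x | B (x + t)] = lebesgue_measure B.
Proof.
move=> mB.
pose f : R -> R := fun x => x + t.
have mf : measurable_fun setT f by exact: measurable_shift.
pose F : {mfun R >-> R} := HB.pack f (isMeasurableFun.Build _ _ _ _ f mf).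
apply/esym.
apply: (@lebesgue_measure_unique R
  (@pushforward _ _ (measurableTypeR R) (measurableTypeR R) R lebesgue_measure F)) => //.
move=> _ [[a b] ab <-] /=.
rewrite /pushforward [X in _ = lebesgue_measure X](_ : _ = `](a - t), (b - t)]%classic).
  rewrite !lebesgue_measure_itv/= !lte_fin ltrD2r -!EFinB.
  by case: ifP => // _; congr EFin; ring.
by apply/seteqP; split=> x /=; rewrite !in_itv/= ltrBlDr lerBrDr.
Qed.

Lemma measurable_EFin_normal_pdf (R : realType) (m s : R)
    (D : set (measurableTypeR R)) :
  measurable_fun D (fun x : measurableTypeR R => (normal_pdf m s x)%:E).
Proof.
apply: measurable_funTS; apply/measurable_EFinP.
exact: (@measurable_normal_pdf R m s).
Qed.

Lemma normal_prob_shift (R : realType) (m t : R) (B : set R) :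
  measurable B -> normal_prob m 1 [set x | B (x + t)] = normal_prob (m + t) 1 B.
Proof.
move=> mB.
pose f : R -> R := fun x => x + t.
have mf : measurable_fun setT f by exact: measurable_shift.
pose F : {mfun R >-> R} := HB.pack f (isMeasurableFun.Build _ _ _ _ f mf).
rewrite /normal_prob.
pose push :=
  @pushforward _ _ (measurableTypeR R) (measurableTypeR R) R lebesgue_measure F.
transitivity (\int[push]_(x in B) (normal_pdf (m + t) 1 x)%:E)%E; last first.
  by apply: eq_measure_integral => A mA _; exact: (lebesgue_measure_shift t mA).
rewrite ge0_integral_pushforward.
- apply: eq_integral => x _; congr EFin.
  by rewrite !normal_pdfE ?oner_neq0//= /normal_fun /f; congr (_ * expR _); ring.
- exact: mf.
- exact: mB.
- exact: measurable_EFin_normal_pdf.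
- by move=> x _; rewrite lee_fin normal_pdf_ge0.
Qed.

Lemma normal_peak1_le1 (R : realType) : @normal_peak R 1 <= 1.
Proof.
have pi2 := pi_ge2 R.
have pi1 : 1 <= pi *+ 2 :> R by rewrite -mulr_natr; lra.
rewrite /normal_peak expr1n mul1r invf_le1 ?sqrtr_gt0 ?(lt_le_trans ltr01 pi1)//.
by rewrite -[X in X <= _]sqrtr1 ler_sqrt// (le_trans ler01 pi1).
Qed.

Lemma normal_prob_itv_le (R : realType) (m a b : R) : a <= b ->
  (normal_prob m 1 `]a, b]%classic <= (b - a)%:E)%E.
Proof.
move=> ab; rewrite /normal_prob.
apply: (@le_trans _ _ (\int[lebesgue_measure]_(x in `]a, b]%classic) (cst 1%:E x))%E).
  apply: ge0_le_integral => //=.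
  - by move=> x _; rewrite lee_fin normal_pdf_ge0.
  - exact: measurable_EFin_normal_pdf.
  - move=> x _; rewrite lee_fin (le_trans (normal_pdf_ub _ _ _)) ?oner_neq0//.
    exact: normal_peak1_le1.
rewrite integral_cst//= mul1e lebesgue_measure_itv/= lte_fin; case: ifP => _.
  by rewrite -EFinB lee_fin.
by rewrite lee_fin subr_ge0.
Qed.

(** [H] acts as the positive set of a Hahn decomposition of [m1 - m2]: going from [B] to [H] drops a
    part where [m1 - m2] is at most 0 and adds one where it is at least 0, so a bound at [H] is a
    bound at [B]. *)
Lemma le_measure_domination (R : realType) (d : measure_display)
    (T : measurableType d) (m1 m2 : probability T R) (H B : set T) (t : R) :
  measurable H -> measurable B ->
  (m1 (B `\` H) <= m2 (B `\` H))%E -> (m2 (H `\` B) <= m1 (H `\` B))%E ->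
  (m1 H <= m2 H + t%:E)%E -> (m1 B <= m2 B + t%:E)%E.
Proof.
move=> mH mB.
have DI (m : probability T R) A C : measurable A -> measurable C ->
    m A = (m (A `\` C) + m (A `&` C))%E by exact: measureDI.
rewrite (DI m1 B H mB mH) (DI m2 B H mB mH).
rewrite (DI m1 H B mH mB) (DI m2 H B mH mB) ![H `&` B]setIC.
have fin (m : probability T R) A : measurable A -> m A = (fine (m A))%:E.
  by move=> mA; rewrite fineK ?fin_num_measure.
have mBH := measurableD mB mH; have mHB := measurableD mH mB.
have mI := measurableI _ _ mB mH.
rewrite (fin m1 _ mBH) (fin m2 _ mBH) (fin m1 _ mHB) (fin m2 _ mHB).
rewrite (fin m1 _ mI) (fin m2 _ mI) -!EFinD !lee_fin.
lra.
Qed.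

Lemma normal_prob_shift_le (R : realType) (t : R) (B : set R) :
  0 <= t -> measurable B ->
  (normal_prob t 1 B <= normal_prob 0 1 B + t%:E)%E.
Proof.
move=> t0 mB.
(* The density of [normal_prob t 1] exceeds that of [normal_prob 0 1] exactly on [H]. *)
pose H : set R := `]t / 2, +oo[%classic.
have mH : measurable H by exact: measurable_itv.
pose nt := normal_prob t 1 : probability (measurableTypeR R) R.
pose n0 := normal_prob 0 1 : probability (measurableTypeR R) R.
have pdfE m (x : R) : normal_pdf m 1 x = normal_peak 1 * expR (- (x - m) ^+ 2 / 2).
  by rewrite normal_pdfE ?oner_neq0 // /normal_fun expr1n.
have le1 : (nt (B `\` H) <= n0 (B `\` H))%E.
  apply: ge0_le_integral => //=.
  - exact: measurableD.
  - by move=> x _; rewrite lee_fin normal_pdf_ge0.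
  - exact: measurable_EFin_normal_pdf.
  - exact: measurable_EFin_normal_pdf.
  - move=> x [_]; rewrite /H/= in_itv/= andbT => /negP; rewrite -leNgt => xt.
    by rewrite lee_fin !pdfE ler_pM2l ?normal_peak_gt0 ?oner_neq0 // ler_expR; nra.
have le2 : (n0 (H `\` B) <= nt (H `\` B))%E.
  apply: ge0_le_integral => //=.
  - exact: measurableD.
  - by move=> x _; rewrite lee_fin normal_pdf_ge0.
  - exact: measurable_EFin_normal_pdf.
  - exact: measurable_EFin_normal_pdf.
  - move=> x []; rewrite /H/= in_itv/= andbT => xt _.
    by rewrite lee_fin !pdfE ler_pM2l ?normal_peak_gt0 ?oner_neq0 // ler_expR; nra.
(* Translated back by [t], the half-line [H] gains only an interval of length [t], whose mass is at
   most [t] because the density is at most 1. *)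
have le3 : (nt H <= n0 H + t%:E)%E.
  have -> : nt H = n0 [set x | H (x + t)].
    by rewrite /n0/= (normal_prob_shift 0 t mH) add0r.
  rewrite [X in n0 X](_ : _ = `](- (t / 2)), (t / 2)]%classic `|` H); last first.
    by apply/seteqP; split=> x /=; rewrite /H/= !in_itv/= !andbT;
      [move=> ?; case: (leP x (t / 2)) => ?; [left; lra|right]|case; lra].
  apply: (le_trans (measureU2 n0 _ _)) => //; rewrite addeC leeD2l//.
  have tt : - (t / 2) <= t / 2 by lra.
  by apply: le_trans (normal_prob_itv_le 0 tt) _; rewrite lee_fin; lra.
exact: (@le_measure_domination R _ (measurableTypeR R) nt n0 H B t mH mB le1 le2 le3).
Qed.

Lemma normal_prob_tv (R : realType) (t : R) (B : set R) : measurable B ->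
  (normal_prob 0 1 [set x | B (x + t)%R] <= normal_prob 0 1 B + `|t|%:E)%E.
Proof.
move=> mB; have [t0|t0] := leP 0 t.
  by rewrite normal_prob_shift// add0r ger0_norm// normal_prob_shift_le.
(* For negative [t], the bound for the shift [- t] is applied to the complement of [C], and
   complements are taken again at the end. *)
rewrite ltr0_norm//.
pose C := [set x | B (x + t)].
have mC : measurable C.
  by rewrite -[C]setTI; apply: (measurable_shift t).
have nt0 : 0 <= - t by lra.
have := normal_prob_shift_le nt0 (measurableC mC).
rewrite -(add0r (- t)) -normal_prob_shift ?add0r; last exact: measurableC.
have -> : [set x | (~` C) (x - t)] = ~` B.
  by apply/seteqP; split => x /=; rewrite /C/= subrK.
rewrite -/C.
have aux d (T : measurableType d) (P : probability T R) (X Y : set T) (s : R) :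
    measurable X -> measurable Y ->
  (P (~` X) <= P (~` Y) + s%:E -> P Y <= P X + s%:E)%E.
  move=> mX mY; rewrite (probability_setC P mX) (probability_setC P mY).
  rewrite -(fineK (fin_num_measure P _ mX)) -(fineK (fin_num_measure P _ mY)).
  by rewrite -!EFinB -!EFinD !lee_fin; lra.
exact: (aux _ _ (normal_prob 0 1)).
Qed.

(** * Shifting the mean of the noise matrix *)

Definition mx_rect (R : realType) (n : nat) (B : 'I_n * 'I_n -> set R) :
    set 'M[R]_n :=
  [set M | forall ij, B ij (M ij.1 ij.2)].

Definition mx_rects (R : realType) (n : nat) : set (set 'M[R]_n) :=
  [set mx_rect B | B in [set B | forall ij, measurable (B ij)]].

(** Generating the sigma-algebra by rectangles, a family closed under intersection, allows laws of
    random matrices to be compared on rectangles alone. *)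
Definition mxT (R : realType) (n : nat) := g_sigma_algebraType (@mx_rects R n).
HB.instance Definition _ (R : realType) (n : nat) := Measurable.on (mxT R n).

Lemma mx_rects_setI (R : realType) (n : nat) : setI_closed (@mx_rects R n).
Proof.
move=> _ _ [B mB <-] [C mC <-]; exists (fun ij => B ij `&` C ij).
  by move=> ij; apply: measurableI.
by apply/seteqP; split=> M /=;
  [move=> BC; split=> ij; have [] := BC ij | move=> [hB hC] ij; split].
Qed.

Lemma measurable_mx_rects (R : realType) (n : nat) (A : set 'M[R]_n) :
  @measurable_mx R n A -> measurable (A : set (mxT R n)).
Proof.
apply: (smallest_sub (C := sigma_algebra setT)).
  exact: sigma_algebra_measurable.
move=> _ [ij _ [B mB <-]]; apply: sub_sigma_algebra.
exists (fun kl => if kl == ij then B else setT).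
  by move=> kl; case: ifP => _.
apply/seteqP; split=> M /=.
  by move/(_ ij); rewrite eqxx; split.
by move=> [_ BM] kl; case: eqP => // ->.
Qed.

Lemma measurable_to_mx (R : realType) (n : nat) (d : measure_display)
    (W : measurableType d) (f : W -> 'M[R]_n) :
  (forall i j, measurable_fun setT (fun w => f w i j)) ->
  measurable_fun setT (f : W -> mxT R n).
Proof.
move=> mf; apply: (@measurability _ _ W (mxT R n) setT f (@mx_rects R n)) => //.
move=> _ [_ [B mB <-] <-].
rewrite (_ : _ `&` _ = \bigcap_(ij in [set: 'I_n * 'I_n])
    ((fun w => f w ij.1 ij.2) @^-1` B ij)).
  apply: fin_bigcap_measurable => // ij _.
  by rewrite -[X in measurable X]setTI; apply: mf.
by apply/seteqP; split=> w /=;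
  [move=> [_ h] ij _; exact: h | move=> h; split=> // ij; exact: h].
Qed.

Lemma measurable_mx_coef (R : realType) (n : nat) (i j : 'I_n) :
  measurable_fun setT (fun M : mxT R n => (M : 'M[R]_n) i j).
Proof.
move=> _ B mB; rewrite setTI; apply: measurable_mx_rects.
by apply: sub_sigma_algebra; exists (i, j) => //; exists B => //; rewrite setTI.
Qed.

Lemma measurable_mx_shift (R : realType) (n : nat) (M0 : 'M[R]_n) :
  measurable_fun setT (fun M : mxT R n => (M0 + M : 'M[R]_n) : mxT R n).
Proof.
apply: measurable_to_mx => i j.
under eq_fun do rewrite mxE.
by apply: measurable_funD => //; exact: measurable_mx_coef.
Qed.

Definition mx_upd (R : realType) (n : nat) (k : 'I_n * 'I_n)
    (M : 'M[R]_n) (x : R) : 'M[R]_n :=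
  \matrix_(i, j) if (i, j) == k then x else M i j.

Section noise.
Context (d : measure_display) (T : measurableType d) (R : realType)
  (P : probability T R) (n : nat) (E : 'I_n * 'I_n -> {RV P >-> R}).
Hypothesis gE : gaussian_noise E.
Local Notation nu := (normal_prob 0 1 : probability (measurableTypeR R) R).

Lemma measurable_noise : measurable_fun setT (noise_mx E : T -> mxT R n).
Proof.
apply: measurable_to_mx => i j.
rewrite (_ : (fun w => _) = E (i, j)); last by apply/funext => w; rewrite mxE.
exact: measurable_funPT.
Qed.

Lemma measurable_noise_upd k :
  measurable_fun setT (fun wx : T * measurableTypeR R =>
    mx_upd k (noise_mx E wx.1) wx.2 : mxT R n).
Proof.
apply: measurable_to_mx => i j.
have [ijk|ijk] := eqVneq (i, j) k.
  rewrite (_ : (fun w => _) = snd); last by apply/funext => w; rewrite mxE ijk eqxx.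
  exact: measurable_snd.
rewrite (_ : (fun w => _) = E (i, j) \o fst); last first.
  by apply/funext => w; rewrite !mxE (negPf ijk).
by apply: measurableT_comp; [exact: measurable_funPT|exact: measurable_fst].
Qed.

(** On a rectangle, independence splits both sides into the mass of the constraints off [k] times
    the standard Gaussian mass of the side [B k]. Rectangles form a generating pi-system, so the two
    laws coincide. *)
Lemma noise_resample k (A : set (mxT R n)) : measurable A ->
  P (noise_mx E @^-1` A) =
  (P \x nu)%E [set wx | A (mx_upd k (noise_mx E wx.1) wx.2)].
Proof.
move=> mA.
have mf := measurable_noise.
have mg := @measurable_noise_upd k.
pose F : {mfun T >-> mxT R n} :=
  HB.pack (noise_mx E : T -> mxT R n) (isMeasurableFun.Build _ _ _ _ _ mf).
pose G : {mfun (T * measurableTypeR R)%type >-> mxT R n} :=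
  HB.pack (fun wx : T * measurableTypeR R => mx_upd k (noise_mx E wx.1) wx.2 : mxT R n)
    (isMeasurableFun.Build _ _ _ _ _ mg).
have h := @measure_unique _ R (mxT R n) (@mx_rects R n) (fun=> setT).
apply: (h erefl _ _ _ (pushforward P F) (pushforward (P \x nu)%E G)) => //; clear h.
- exact: mx_rects_setI.
- by move=> _; exists (fun=> setT) => //; apply/seteqP; split.
- by apply/seteqP; split => // ? _; exists 0%N.
- move=> _ [B mB <-].
  have [indep law] := gE.
  pose H := \bigcap_(ij in [set` ([set~ k]%SET : {set 'I_n * 'I_n})]) (E ij @^-1` B ij).
  have mH : measurable H.
    apply: fin_bigcap_measurable => // ij _.
    by rewrite -[X in measurable X]setTI; apply: measurable_funP.
  have e1 : G @^-1` (mx_rect B) = H `*` B k.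
    apply/seteqP; split => [[w x]|[w x]] /=.
      move=> h; split; last by have := h k; rewrite mxE -surjective_pairing eqxx.
      move=> ij /=; rewrite finset.in_setC1 => /negPf ijk.
      by have := h ij; rewrite !mxE -surjective_pairing ijk.
    move=> [h Bk] ij; rewrite !mxE -surjective_pairing; case: eqP => [->//|/eqP ijk].
    by apply: h; rewrite /= finset.in_setC1.
  have e2 : F @^-1` (mx_rect B) =
      \bigcap_(ij in [set` ([set: 'I_n * 'I_n]%SET : {set 'I_n * 'I_n})]) (E ij @^-1` B ij).
    apply/seteqP; split=> w /= h ij.
      by move=> _ /=; have := h ij; rewrite mxE -surjective_pairing.
    by rewrite mxE -surjective_pairing; apply: h; rewrite /= finset.in_setT.
  change (P (F @^-1` mx_rect B) = (P \x nu)%E (G @^-1` mx_rect B)).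
  have -> : (P \x nu)%E (G @^-1` mx_rect B) = (P H * P (E k @^-1` B k))%E.
    rewrite e1 product_measure1E; [|exact: mH|exact: mB].
    by congr (_ * _)%E; exact: (esym (law k _ (mB k))).
  rewrite e2.
  rewrite indep// indep// (bigD1 k) ?finset.in_setT//= muleC; congr (_ * _)%E.
  by apply: eq_bigl => ij; rewrite finset.in_setT finset.in_setC1.
- move=> _; change (P (F @^-1` setT) < +oo)%E.
  by rewrite preimage_setT probability_setT ltry.
Qed.

(* Resampling the entry [k] makes it independent of the others by construction, so
   the shift acts on one-dimensional sections, where [normal_prob_tv] applies. *)
Lemma noise_shift_entry (k : 'I_n * 'I_n) (M : 'M[R]_n) (t : R) (A : set (mxT R n)) :
  measurable A ->
  (P [set w | A (M + t *: delta_mx k.1 k.2 + noise_mx E w)%R] <=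
   P [set w | A (M + noise_mx E w)%R] + `|t|%:E)%E.
Proof.
move=> mA.
pose S (M' : 'M[R]_n) : set (T * measurableTypeR R) :=
  [set wx | A (M' + mx_upd k (noise_mx E wx.1) wx.2)].
have mA' (M' : 'M[R]_n) : measurable [set X : mxT R n | A (M' + X)].
  by rewrite -[X in measurable X]setTI; apply: measurable_mx_shift.
have mS M' : measurable (S M').
  by rewrite -[X in measurable X]setTI;
    apply: (@measurable_noise_upd k measurableT _ (mA' M')).
have PS M' : P [set w | A (M' + noise_mx E w)%R] =
    (\int[P]_w (nu \o xsection (S M')) w)%E.
  exact: (noise_resample k (mA' M')).
rewrite !PS.
(* Adding [t] to the mean at [k] amounts to adding [t] to the fresh coordinate, once the other
   entries are frozen. *)
have sec w : xsection (S (M + t *: delta_mx k.1 k.2)) w =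
    [set x | xsection (S M) w (x + t)%R].
  apply/seteqP; suff e x : M + t *: delta_mx k.1 k.2 + mx_upd k (noise_mx E w) x
      = M + mx_upd k (noise_mx E w) (x + t).
    by split=> x /=; rewrite /xsection/= !inE /S/= e.
  apply/matrixP => i j; rewrite !mxE -xpair_eqE -surjective_pairing.
  by case: eqP => _; rewrite ?mulr1 ?mulr0 ?addr0 // -addrA [t + x]addrC.
apply: (@le_trans _ _ (\int[P]_w ((nu \o xsection (S M)) w + cst `|t|%:E w))%E).
  apply: ge0_le_integral => //=.
  - exact: measurable_fun_xsection.
  - by apply: emeasurable_funD => //; exact: measurable_fun_xsection.
  - move=> w _; rewrite sec; apply: normal_prob_tv; exact: (measurable_xsection w (mS M)).
rewrite ge0_integralD//.
- by rewrite integral_cst//= (@probability_setT _ _ _ P) mule1.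
- exact: measurable_fun_xsection.
- by move=> w _; rewrite lee_fin.
Qed.

(** [D] is added one entry at a time, and the costs given by [noise_shift_entry] accumulate. *)
Lemma noise_shift (M D : 'M[R]_n) (A : set (mxT R n)) : measurable A ->
  (P [set w | A (M + D + noise_mx E w)%R] <=
   P [set w | A (M + noise_mx E w)%R] + (\sum_i \sum_j `|D i j|)%:E)%E.
Proof.
move=> mA.
suff H (r : seq ('I_n * 'I_n)) :
  (P [set w | A (M + \sum_(k <- r) D k.1 k.2 *: delta_mx k.1 k.2 + noise_mx E w)%R] <=
   P [set w | A (M + noise_mx E w)%R] + (\sum_(k <- r) `|D k.1 k.2|)%:E)%E.
  rewrite {1}[D]matrix_sum_delta !pair_bigA /=; exact: H.
elim: r => [|k r IH]; first by rewrite !big_nil addr0 adde0.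
rewrite !big_cons [_ *: _ + _]addrC addrA.
apply: (le_trans (noise_shift_entry _ _ _ mA)).
by rewrite [(`|_| + _)%R]addrC EFinD addeA leeD2r.
Qed.

End noise.

(** * Long edges and the loss *)

(** Adjacency, loops included, in the path; written with successors to avoid truncated
    subtraction. *)
Definition within1 (i j : nat) : bool := (i <= j.+1)%N && (j <= i.+1)%N.

Lemma toeplitz_two_ones (R : realType) (n : nat) (u : R) (i j : 'I_n) :
  toeplitz (u *: two_ones R n) i j = if within1 i j then u else 0.
Proof.
rewrite !mxE /within1 /= (_ : (_ < 2)%N = (i <= j.+1)%N && (j <= i.+1)%N); last by lia.
by case: ifP => _; rewrite ?mulr1 ?mulr0.
Qed.

Lemma conj_perm_mx (R : realType) (n : nat) (s : 'S_n) (M : 'M[R]_n) i j :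
  conj_mx (perm_mx s) M i j = M (s i) (s j).
Proof.
by rewrite /conj_mx -row_permE tr_perm_mx -col_permE !mxE.
Qed.

Lemma signalE (R : realType) (n : nat) (u : R) (s : 'S_n) (i j : 'I_n) :
  signal (u *: two_ones R n) s i j =
  if within1 (s^-1 i)%g (s^-1 j)%g then u else 0.
Proof. by rewrite /signal tr_perm_mx conj_perm_mx toeplitz_two_ones. Qed.

(* [q p] is the position given to the vertex [p] of the path. *)
Definition long_edge (n : nat) (q : 'S_n) (p : 'I_n) : bool :=
  [exists p' : 'I_n, ((p.+1 == p') || (p'.+1 == p)) &&
    ((q p + 2 < q p')%N || (q p' + 2 < q p)%N)].

(** The vertices [x], [y], [z] below are [p - 1], [p + 1], [p + 3], fixed by the exchange. If two
    positions differ by [k >= 1], at most [5 - k] positions are within 2 of both, and for [k <= 2]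
    these include the two themselves. At most two positions are thus left for three vertices. *)
Lemma long_edge_swap (n : nat) (q : 'S_n) (p p2 : 'I_n) :
  (0 < p)%N -> p2 = p.+2 :> nat -> (p + 3 < n)%N ->
  [|| long_edge q p, long_edge q p2, long_edge (tperm p p2 * q)%g p |
      long_edge (tperm p p2 * q)%g p2].
Proof.
move=> p0 p2E pn; apply: contraT; rewrite !negb_or !negb_exists.
move=> /and4P[/forallP h1 /forallP h2 /forallP h3 /forallP h4].
have Hx : (p.-1 < n)%N by lia.
have Hy : (p.+1 < n)%N by lia.
have Hz : (p.+3 < n)%N by lia.
pose x := Ordinal Hx; pose y := Ordinal Hy; pose z := Ordinal Hz.
have tE (v : 'I_n) : p != v -> p2 != v -> tperm p p2 v = v by exact: tpermD.
have xE : tperm p p2 x = x by apply: tE; rewrite -val_eqE /=; lia.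
have yE : tperm p p2 y = y by apply: tE; rewrite -val_eqE /=; lia.
have zE : tperm p p2 z = z by apply: tE; rewrite -val_eqE /=; lia.
move: (h1 x) (h1 y) (h2 y) (h2 z) (h3 x) (h3 y) (h4 y) (h4 z).
rewrite !permM tpermL tpermR xE yE zE.
have neq (a b : 'I_n) : a != b :> nat -> q a != q b :> nat.
  by apply: contraNneq => /val_inj/perm_inj ->.
have n1 : q p != q p2 :> nat by apply: neq; lia.
have n2 : q x != q y :> nat by apply: neq => /=; lia.
have n3 : q x != q z :> nat by apply: neq => /=; lia.
have n4 : q y != q z :> nat by apply: neq => /=; lia.
have n5 : q p != q x :> nat by apply: neq => /=; lia.
have n6 : q p != q y :> nat by apply: neq => /=; lia.
have n7 : q p != q z :> nat by apply: neq => /=; lia.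
have n8 : q p2 != q x :> nat by apply: neq => /=; lia.
have n9 : q p2 != q y :> nat by apply: neq => /=; lia.
have n10 : q p2 != q z :> nat by apply: neq => /=; lia.
have e1 : (p.+1 == x) || (x.+1 == p) by rewrite ?p2E /= ?(prednK p0) ?eqxx ?orbT.
have e2 : (p.+1 == y) || (y.+1 == p) by rewrite ?p2E /= ?(prednK p0) ?eqxx ?orbT.
have e3 : (p2.+1 == y) || (y.+1 == p2) by rewrite ?p2E /= ?(prednK p0) ?eqxx ?orbT.
have e4 : (p2.+1 == z) || (z.+1 == p2) by rewrite ?p2E /= ?(prednK p0) ?eqxx ?orbT.
rewrite e1 e2 e3 e4 /=.
move: (nat_of_ord (q p)) (nat_of_ord (q p2)) (nat_of_ord (q x))
  (nat_of_ord (q y)) (nat_of_ord (q z)) n1 n2 n3 n4 n5 n6 n7 n8 n9 n10.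
clear; lia.
Qed.

Lemma long_edge_row (R : realType) (n : nat) (u : R) (q : 'S_n) (M A : 'M[R]_n)
    (p : 'I_n) :
  0 <= u -> robinson M ->
  (forall i j, A i j = if within1 (q^-1 i)%g (q^-1 j)%g then u else 0) ->
  long_edge q p ->
  u ^+ 2 / 2 <= \sum_j (A (q p) j - M (q p) j) ^+ 2.
Proof.
move=> u0 [_ Ml Mr] AE /existsP[p' /andP[pp' far]].
(* [p] has at most two neighbours, [p'] among them: one of the two positions next
   to [q p] in the direction of [q p'] holds a zero of the row. *)
suff [z [zp' nz le]] : exists z, [/\ z != q p',
    ~~ within1 p (q^-1 z)%g & M (q p) (q p') <= M (q p) z].
  rewrite (bigD1 z)// (bigD1 (q p')) 1?eq_sym//=.
  rewrite !AE !permK (negPf nz).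
  have -> : within1 p p' by rewrite /within1; lia.
  have S0 : 0 <= \sum_(i < n | (i != z) && (i != q p')) (A (q p) i - M (q p) i) ^+ 2.
    by apply: sumr_ge0 => i _; exact: sqr_ge0.
  move: S0 le; move: (\sum_(i < n | _) _) (M _ _) (M _ _); clear -u0 => S b a S0 ab.
  have := sqr_ge0 (u - a); rewrite sub0r sqrrN => ua.
  (* Here [a <= b] are the entries of [M] where the row holds [u] and 0. If [b > u], the term
     [b ^+ 2] suffices; otherwise the cost is at least [b ^+ 2 + (u - b) ^+ 2], which is smallest at
     [b = u / 2]. *)
  have [bu|ub] := leP b u; last first.
    have : u ^+ 2 <= b ^+ 2 by apply: lerXn2r; rewrite ?nnegrE; lra.
    by have := sqr_ge0 u; lra.
  have : (u - b) ^+ 2 <= (u - a) ^+ 2 by apply: lerXn2r; rewrite ?nnegrE; lra.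
  have := sqr_ge0 (u - b *+ 2); rewrite !expr2 => ? ?; nra.
have key (z1 z2 : 'I_n) : z1 != z2 ->
    z1 != q p -> z2 != q p -> z1 != q p' -> z2 != q p' ->
    ~~ within1 p (q^-1 z1)%g || ~~ within1 p (q^-1 z2)%g.
  move=> z12 z1p z2p z1p' z2p'; rewrite -negb_and; apply/negP.
  have y12 : (q^-1 z1)%g != (q^-1 z2)%g by rewrite (inj_eq perm_inj).
  have neq (z v : 'I_n) : z != q v -> (q^-1 z)%g != v.
    by apply: contra_neq => <-; rewrite permKV.
  move: y12 (neq _ _ z1p) (neq _ _ z2p) (neq _ _ z1p') (neq _ _ z2p').
  rewrite -!val_eqE /= /within1; move: pp'; clear => *; lia.
case/orP: far => far.
  have Hz1 : (q p + 1 < n)%N by have := ltn_ord (q p'); lia.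
  have Hz2 : (q p + 2 < n)%N by have := ltn_ord (q p'); lia.
  have /orP[nz|nz] : ~~ within1 p (q^-1 (Ordinal Hz1))%g ||
      ~~ within1 p (q^-1 (Ordinal Hz2))%g.
    by apply: key; rewrite -val_eqE /=; lia.
    exists (Ordinal Hz1); split=> //; first by rewrite -val_eqE /=; lia.
    by apply: Mr => /=; lia.
  exists (Ordinal Hz2); split=> //; first by rewrite -val_eqE /=; lia.
  by apply: Mr => /=; lia.
(* Mirror case, to the left of [q p]; the subtractions are not truncated because
   [q p' + 2 < q p]. *)
have Hz1 : (q p - 1 < n)%N by have := ltn_ord (q p); lia.
have Hz2 : (q p - 2 < n)%N by have := ltn_ord (q p); lia.
have /orP[nz|nz] : ~~ within1 p (q^-1 (Ordinal Hz1))%g ||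
    ~~ within1 p (q^-1 (Ordinal Hz2))%g.
  by apply: key; rewrite -val_eqE /=; lia.
  exists (Ordinal Hz1); split=> //; first by rewrite -val_eqE /=; lia.
  by apply: Ml => /=; lia.
exists (Ordinal Hz2); split=> //; first by rewrite -val_eqE /=; lia.
by apply: Ml => /=; lia.
Qed.

(** Conjugation by [t] places the vertex [v] of the path at position [q v]. Distinct vertices occupy
    distinct rows, so the costs from [long_edge_row] add up. *)
Lemma ell2_ge (R : realType) (n : nat) (u : R) (s t : 'S_n) :
  (0 < n)%N -> 0 <= u ->
  u / Num.sqrt (2 * n%:R) * (\sum_p (long_edge (s * t^-1)%g p)%:R) <=
  ell2 (signal (u *: two_ones R n) s) t.
Proof.
move=> n0 u0; set q := (s * t^-1)%g.
set A := conj_mx (perm_mx t) (signal (u *: two_ones R n) s).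
have AE i j : A i j = if within1 (q^-1 i)%g (q^-1 j)%g then u else 0.
  by rewrite /A conj_perm_mx signalE /q invMg invgK !permM.
(* The zero matrix is Robinson, so the infimum is over a nonempty set. *)
apply: lb_le_inf.
  exists (frobenius (A - 0)), 0 => //.
  by split=> [|i j k _ _|i j k _ _]; rewrite ?trmx0 ?mxE.
move=> _ [M rM <-]; rewrite -/A /frobenius.
set N := \sum_p _.
have N0 : 0 <= N by apply: sumr_ge0.
have Nn : N <= n%:R.
  rewrite -[n in n%:R]card_ord -sumr_const; apply: ler_sum => p _.
  by case: long_edge.
have n0' : 0 < n%:R :> R by rewrite ltr0n.
(* [sqrt (u^2 N / 2) >= u N / sqrt (2 n)] because [N <= n]. *)
have cost : u ^+ 2 / 2 * N <= \sum_i \sum_j ((A - M) i j) ^+ 2.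
  rewrite (reindex_inj (@perm_inj _ q)) mulr_sumr; apply: ler_sum => p _ /=.
  under eq_bigr do rewrite !mxE.
  case: (boolP (long_edge q p)) => [lp|_]; last first.
    by rewrite mulr0; apply: sumr_ge0 => j _; exact: sqr_ge0.
  rewrite mulr1; apply: le_trans (long_edge_row u0 rM AE lp) _.
  by apply: ler_sum => j _; rewrite !mxE.
have x0 : 0 <= u / Num.sqrt (2 * n%:R) * N by rewrite !mulr_ge0 ?invr_ge0 ?sqrtr_ge0.
rewrite -(ger0_norm x0) -sqrtr_sqr ler_sqrt; last first.
  by apply: sumr_ge0 => i _; apply: sumr_ge0 => j _; exact: sqr_ge0.
apply: le_trans cost.
rewrite !exprMn exprVn sqr_sqrtr ?mulr_ge0 ?ler0n//.
rewrite -[leLHS]mulrA -[leRHS]mulrA; apply: ler_wpM2l; first exact: sqr_ge0.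
rewrite invfM -mulrA; apply: ler_wpM2l; first by rewrite invr_ge0.
by rewrite mulrC ler_pdivrMr// expr2; exact: ler_wpM2l.
Qed.

(** When the adjacency of two vertices changes, one of them is [p] or [p + 2], and the other is
    equal or adjacent to one of these. Both lie in the window [W] from [p - 1] to [p + 3], which
    leaves at most 25 pairs. *)
Lemma signal_swap_dist (R : realType) (n : nat) (u : R) (s : 'S_n) (p p2 : 'I_n) :
  0 <= u -> p2 = p.+2 :> nat ->
  \sum_i \sum_j `|(signal (u *: two_ones R n) (tperm p p2 * s)%g
    - signal (u *: two_ones R n) s) i j| <= 25 * u.
Proof.
move=> u0 p2E.
pose W := [pred i : 'I_n | (p.-1 <= i < p + 4)%N].
have cW : (#|W| <= 5)%N.
  pose f (i : 'I_n) : 'I_5 := inord (i - p.-1).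
  rewrite -(card_in_imset (f := f)); first by rewrite (leq_trans (max_card _)) ?card_ord.
  move=> i j; rewrite !inE => Wi Wj /(congr1 val); rewrite /= !inordK; try lia.
  by move=> ?; apply: val_inj => /=; lia.
apply: (@le_trans _ _ (\sum_(i in W) \sum_(j in W) u)); last first.
  rewrite !sumr_const -mulrnA -[leLHS]mulr_natl; apply: ler_wpM2r => //; rewrite ler_nat.
  by apply: (@leq_trans (5 * 5)%N) => //; exact: leq_mul.
(* Reindexing rows and columns by [s] labels the entries by vertices of the path. *)
rewrite (reindex_inj (@perm_inj _ s)) [leRHS]big_mkcond /=; apply: ler_sum => i _.
rewrite (reindex_inj (@perm_inj _ s)) /=.
have tE (v : 'I_n) : nat_of_ord (tperm p p2 v) =
    if nat_of_ord v == p then p.+2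
    else if nat_of_ord v == p.+2 then nat_of_ord p else nat_of_ord v.
  by rewrite permE /= -p2E !(inj_eq val_inj); do 2?case: ifP => //.
rewrite (_ : (if _ then _ else _) =
    \sum_j (if (i \in W) && (j \in W) then u else 0)); last first.
  by case: (i \in W); [rewrite big_mkcond|rewrite big1].
have mxB (X Y : 'M[R]_n) a b : (X - Y) a b = X a b - Y a b by rewrite !mxE.
apply: ler_sum => j _; rewrite mxB !signalE invMg tpermV !permM !permK.
have /orP[/eqP ->|->] : (within1 (tperm p p2 i) (tperm p p2 j) == within1 i j) ||
    ((i \in W) && (j \in W)).
  rewrite !tE !inE /within1.
  move: (nat_of_ord i) (nat_of_ord j) (nat_of_ord p); clear => a b c.
  by case: (a =P c) => ?; case: (a =P c.+2) => ?; case: (b =P c) => ?;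
    case: (b =P c.+2) => ?; lia.
  by rewrite subrr normr0; case: ifP.
by do 2?case: ifP => _; rewrite ?subrr ?subr0 ?sub0r ?normrN ?normr0 ?ger0_norm.
Qed.

Lemma sum_shift_le (R : realDomainType) (a : nat -> R) (m j n : nat) :
  (forall k, 0 <= a k) -> (m + j <= n)%N ->
  \sum_(0 <= i < m) a (i + j)%N <= \sum_(0 <= i < n) a i.
Proof.
move=> a0 mjn; have -> : \sum_(0 <= i < m) a (i + j)%N = \sum_(j <= i < m + j) a i.
  by have := big_addn 0 (m + j) j predT a; rewrite add0n addnK => ->.
rewrite [leRHS](big_cat_nat (n := j))//=; last by lia.
rewrite [X in _ <= _ + X](big_cat_nat (n := m + j))//=; last by lia.
have S0 x y : 0 <= \sum_(x <= i < y) a i by apply: sumr_ge0.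
have := S0 0%N j; have := S0 (m + j)%N n; lra.
Qed.

(** Summed over the admissible [k], the pairs form two shifted partial sums, each at most the full
    sum. *)
Lemma sum_pairs_ge (R : realDomainType) (a : nat -> R) (c : R) (n : nat) :
  (forall k, 0 <= a k) -> (4 <= n)%N ->
  (forall k, (0 < k)%N -> (k + 3 < n)%N -> c <= a k + a (k + 2)%N) ->
  (n - 4)%:R * c <= 2 * \sum_(0 <= i < n) a i.
Proof.
move=> a0 n4 ac.
have : \sum_(0 <= i < n - 4) c <= \sum_(0 <= i < n - 4) (a (i + 1)%N + a (i + 3)%N).
  rewrite !big_mkord; apply: ler_sum => i _.
  have := ltn_ord i => ilt.
  have -> : (i + 3 = i + 1 + 2)%N by lia.
  by apply: ac; lia.
rewrite sumr_const_nat subn0 big_split /= mulr_natl.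
have le1 := @sum_shift_le _ a (n - 4) 1 n a0 ltac:(lia).
have le3 := @sum_shift_le _ a (n - 4) 3 n a0 ltac:(lia).
lra.
Qed.

(** * Averaging over the permutations *)

Section lower_bound.
Context (d : measure_display) (T : measurableType d) (R : realType)
  (P : probability T R) (n : nat) (E : 'I_n * 'I_n -> {RV P >-> R}).
Hypothesis gE : gaussian_noise E.
Variable hatPi : 'M[R]_n -> 'S_n.
Hypothesis mhat : measurable_estimator hatPi.
Variable u : R.
Hypothesis u0 : 0 < u.

Local Notation X s := (signal (u *: two_ones R n) s).
Local Notation est s w := (hatPi (X s + noise_mx E w)).

Lemma measurable_est_preimage (Q : set 'S_n) :
  measurable (hatPi @^-1` Q : set (mxT R n)).
Proof. by apply: measurable_mx_rects; exact: mhat. Qed.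

Lemma measurable_est (s : 'S_n) (Q : set 'S_n) :
  measurable [set w | Q (est s w)].
Proof.
have mS : measurable ((fun Y : mxT R n => X s + Y : mxT R n) @^-1` (hatPi @^-1` Q)).
  rewrite -[Y in measurable Y]setTI; apply: measurable_mx_shift => //.
  exact: measurable_est_preimage.
rewrite -[Y in measurable Y]setTI.
exact: (@measurable_noise _ _ _ _ _ E measurableT _ mS).
Qed.

(** Every set of estimates has a measurable preimage, so [f] can be arbitrary; this covers the loss
    [ell2]. *)
Lemma measurable_fun_est (s : 'S_n) (f : 'S_n -> R) :
  measurable_fun setT (fun w => f (est s w)).
Proof.
by move=> _ B mB; rewrite setTI; exact: (measurable_est s (f @^-1` B)).
Qed.

Definition long_edge_prob (s : 'S_n) (p : 'I_n) : R :=
  fine (P [set w | long_edge (s * (est s w)^-1)%g p]).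

Lemma long_edge_prob_ge0 s p : 0 <= long_edge_prob s p.
Proof. by rewrite /long_edge_prob fine_ge0. Qed.

(** Estimates in [Q], with no long edge at [p] or [p2] for [s'], have one for [s] by
    [long_edge_swap]. Replacing [X s'] by [X s] changes the probability of [Q] by at most
    [25 * u <= 1 / 2], so the two long-edge events have probabilities summing to at least
    [1 / 2]. *)
Lemma long_edge_prob_swap (s : 'S_n) (p p2 : 'I_n) :
  u <= 50^-1 -> (0 < p)%N -> p2 = p.+2 :> nat -> (p + 3 < n)%N ->
  2^-1 <= long_edge_prob s p + long_edge_prob s p2 +
    (long_edge_prob (tperm p p2 * s)%g p + long_edge_prob (tperm p p2 * s)%g p2).
Proof.
move=> u50 p0 p2E pn; set s' := (tperm p p2 * s)%g.
pose D (v : 'S_n) (p : 'I_n) : set 'S_n := [set t | long_edge (v * t^-1)%g p].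
pose A (v : 'S_n) (Q : set 'S_n) := [set w | Q (est v w)].
have mA v Q : measurable (A v Q) by exact: measurable_est.
have pE v r : P (A v (D v r)) = (long_edge_prob v r)%:E.
  by rewrite /long_edge_prob fineK//; apply: fin_num_measure; exact: (mA v (D v r)).
have U v : (P (A v (D v p `|` D v p2)) <=
    (long_edge_prob v p + long_edge_prob v p2)%:E)%E.
  rewrite EFinD -!pE.
  exact: (@measureU2 _ _ _ P _ _ (mA v (D v p)) (mA v (D v p2))).
pose Q := ~` (D s' p `|` D s' p2).
have QD : Q `<=` D s p `|` D s p2.
  move=> t; rewrite /Q /D /s' /= => /not_orP[/negP/negPf h1 /negP/negPf h2].
  have := long_edge_swap (s * t^-1)%g p0 p2E pn.
  by rewrite -!mulgA in h1 h2 *; rewrite h1 h2 !orbF => /orP.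
have dist : \sum_i \sum_j `|(X s' - X s) i j| <= 2^-1.
  by apply: le_trans (signal_swap_dist _ (ltW u0) p2E) _; lra.
have := noise_shift gE (X s) (X s' - X s) (measurable_est_preimage Q).
have -> : X s + (X s' - X s) = X s' by rewrite addrC subrK.
rewrite -/(A s' Q) -/(A s Q).
have -> : P (A s' Q) = (1 - P (A s' (D s' p `|` D s' p2)))%E.
  by rewrite -probability_setC.
have le1 : (P (A s Q) <= (long_edge_prob s p + long_edge_prob s p2)%:E)%E.
  apply: le_trans (U s); apply: le_measure; rewrite ?inE//; try exact: mA.
  by move=> w; exact: QD.
move: (U s') le1.
have fin Z : measurable Z -> P Z = (fine (P Z))%:E.
  by move=> mZ; rewrite fineK ?fin_num_measure.
rewrite (fin _ (mA s Q)) (fin _ (mA s' (D s' p `|` D s' p2))).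
rewrite -EFinB -EFinD !lee_fin; lra.
Qed.

Lemma expectation_ell2_ge (s : 'S_n) : (0 < n)%N ->
  ((u / Num.sqrt (2 * n%:R) * \sum_p long_edge_prob s p)%:E <=
   'E_P[fun w => ell2 (X s) (est s w)])%E.
Proof.
move=> n0; set C := u / _.
have C0 : 0 <= C by rewrite mulr_ge0 ?invr_ge0 ?sqrtr_ge0 // ltW.
pose B p := [set w | long_edge (s * (est s w)^-1)%g p].
have mB p : measurable (B p).
  exact: (measurable_est s [set t | long_edge (s * t^-1)%g p]).
rewrite expectation.unlock.
(* The number of long edges is written as a sum of indicators, so that [ell2_ge] can be integrated
   pointwise. *)
have -> : (C * \sum_p long_edge_prob s p)%:E =
    (\int[P]_w (C%:E * \sum_p (\1_(B p) w)%:E))%E.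
  rewrite ge0_integralZl//; last first.
  - by move=> w _; apply: sume_ge0.
  - by apply: emeasurable_sum => p; apply/measurable_EFinP/measurable_indic.
  rewrite ge0_integral_sum//; last by move=> p; apply/measurable_EFinP/measurable_indic.
  rewrite EFinM -sumEFin; congr (_ * _)%E; apply: eq_bigr => p _.
  rewrite integral_indic// setIT /long_edge_prob fineK//.
  by apply: fin_num_measure; exact: mB.
apply: ge0_le_integral => //=.
- by move=> w _; rewrite mule_ge0// sume_ge0.
- apply: measurable_funeM; apply: emeasurable_sum => p.
  by apply/measurable_EFinP/measurable_indic.
- apply/measurable_EFinP; exact: (measurable_fun_est s (ell2 (X s))).
- move=> w _; rewrite sumEFin -EFinM lee_fin.
  apply: le_trans (ell2_ge s (est s w) n0 (ltW u0)).
  rewrite ler_wpM2l//; apply: ler_sum => p _; rewrite indicE.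
  case: (boolP (long_edge (s * (est s w)^-1)%g p)) => h; first by rewrite mem_set.
  by rewrite memNset//; exact/negP.
Qed.

End lower_bound.

(** Multiplication by a transposition permutes ['S_n], so after summing over [s] the exchanged terms
    equal the original ones and [F p + F p2 >= G / 4]. By [sum_pairs_ge] the total is at least
    [(n - 4) * G / 8], hence at least [n * G / 16] for [n >= 8], and some [s] reaches the
    average. *)
Lemma average_swap_bound (R : realFieldType) (n : nat) (f : 'S_n -> 'I_n -> R) :
  (8 <= n)%N -> (forall s p, 0 <= f s p) ->
  (forall s (p p2 : 'I_n), (0 < p)%N -> p2 = p.+2 :> nat -> (p + 3 < n)%N ->
    2^-1 <= f s p + f s p2 + (f (tperm p p2 * s)%g p + f (tperm p p2 * s)%g p2)) ->
  exists s, n%:R / 16 <= \sum_p f s p.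
Proof.
case: n f => // m; set n := m.+1 => f n8 f0 fswap.
pose G : R := #|{: 'S_n}|%:R.
have G0 : 0 < G by rewrite ltr0n; apply/card_gt0P; exists 1%g.
pose F p := \sum_s f s p.
have FF (p p2 : 'I_n) : (0 < p)%N -> p2 = p.+2 :> nat -> (p + 3 < n)%N ->
    G / 4 <= F p + F p2.
  move=> p0 p2E pn.
  have Fr q : \sum_s f (tperm p p2 * s)%g q = F q.
    by rewrite [RHS](reindex_inj (mulgI (tperm p p2))).
  have : \sum_(s : 'S_n) 2^-1 <= \sum_s (f s p + f s p2 +
      (f (tperm p p2 * s)%g p + f (tperm p p2 * s)%g p2)).
    by apply: ler_sum => s _; exact: fswap.
  rewrite sumr_const !big_split /= !Fr -[X in X <= _]mulr_natl -/G.
  rewrite -/(F p) -/(F p2); move: (F p) (F p2) (G); clear => *; lra.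
have FS : (n - 4)%:R * (G / 4) <= 2 * \sum_p F p.
  have -> : \sum_p F p = \sum_(0 <= k < n) F (inord k).
    by rewrite big_mkord; apply: eq_bigr => p _; rewrite inord_val.
  apply: sum_pairs_ge => [k||k k0 kn]; [exact: sumr_ge0|lia|].
  by apply: FF; rewrite !inordK; lia.
have n4 : n%:R / 2 <= (n - 4)%:R :> R.
  have n8' : 8 <= n%:R :> R by rewrite ler_nat.
  by rewrite natrB; [lra|lia].
have key : G * (n%:R / 16) <= \sum_p F p.
  move: FS n4; move: (\sum_p _) (n%:R) ((n - 4)%:R) (G) G0; clear => S x y g *; nra.
apply/existsP; apply: contraT; rewrite negb_exists => /forallP H.
have : \sum_s \sum_p f s p < \sum_(s : 'S_n) n%:R / 16.
  apply: ltr_sum => [|s _]; first by apply/hasP; exists 1%g; rewrite ?mem_index_enum.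
  by rewrite ltNge; exact: H.
rewrite exchange_big /= sumr_const -[ltRHS]mulr_natl.
by rewrite ltNge key.
Qed.

Theorem theorem13 (R : realType) :
  exists (c0 c1 : R) (n0 : nat), [/\ 0 < c0, 0 < c1, (0 < n0)%N &
    forall (n : nat) (u : R), (n0 <= n)%N -> 0 < u -> u <= c0 ->
    forall (d : measure_display) (T : measurableType d) (P : probability T R)
      (E : 'I_n * 'I_n -> {RV P >-> R}), gaussian_noise E ->
    forall hatPi : 'M[R]_n -> 'S_n, measurable_estimator hatPi ->
    ((c1 * u * Num.sqrt n%:R)%:E <=
       \big[maxe/-oo]_(s : 'S_n)
         'E_P[fun w => ell2 (signal (u *: two_ones R n) s)
           (hatPi (signal (u *: two_ones R n) s + noise_mx E w))%R])%E].
Proof.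
(* [50^-1] gives [25 * u <= 1 / 2], and 8 gives [n - 4 >= n / 2]. The product of [n / 16] and
   [u / sqrt (2 n)] is [u * sqrt n / (16 * sqrt 2)]; [sqrt 2 <= 2] then yields [32^-1]. *)
exists 50^-1, 32^-1, 8%N; split; rewrite ?invr_gt0//.
move=> n u n8 u0 u50 d T P E gE hatPi mhat.
have n0 : (0 < n)%N by exact: leq_trans n8.
have [s fs] : exists s, n%:R / 16 <= \sum_p long_edge_prob E hatPi u s p.
  apply: average_swap_bound => // [s p|s p p2]; first exact: long_edge_prob_ge0.
  exact: long_edge_prob_swap.
apply: le_trans (le_bigmax_cond _ _ (erefl : xpredT s)).
apply: le_trans (@expectation_ell2_ge _ _ _ _ _ E _ mhat _ u0 s n0).
rewrite lee_fin; set C := u / _.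
have r0 : 0 < Num.sqrt n%:R :> R by rewrite sqrtr_gt0 ltr0n.
have s0 : 0 < Num.sqrt 2 :> R by rewrite sqrtr_gt0.
have C0 : 0 <= C by rewrite divr_ge0 ?sqrtr_ge0 ?ltW.
apply: le_trans (ler_wpM2l C0 fs); rewrite /C sqrtrM//.
have nE : n%:R = Num.sqrt n%:R * Num.sqrt n%:R :> R by rewrite -expr2 sqr_sqrtr.
have s2 : Num.sqrt 2 <= 2 :> R.
  by rewrite -[leRHS]ger0_norm// -sqrtr_sqr ler_sqrt//; lra.
move: r0 s0 s2 nE; move: (Num.sqrt n%:R) (Num.sqrt 2) => r q r0 q0 q2 ->.
have -> : u / (q * r) * (r * r / 16) = u * r / 16 / q.
  by field; rewrite !gt_eqF.
rewrite ler_pdivlMr//.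
have : 0 <= u * r by rewrite mulr_ge0 ?ltW.
nra.
Qed.
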